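(* Let $m$ be a positive integer. Then $$1+m^2+\sum_{k=2}^{[(m+1)/2]}\biggl(\frac{(m+1)m\cdots(m-k+3)\,(m+2-2k)}{k!}\biggr)^2=\frac{(2m+2)(2m+1)\cdots(m+3)}{(m+1)!}.$$
   Context: $[x]$ denotes the largest integer not bigger than $x$. In the sum, $(m+1)m\cdots(m-k+3)$ denotes the product of the $k-1$ consecutive integers from $m-k+3$ to $m+1$; on the right, $(2m+2)(2m+1)\cdots(m+3)$ denotes the product of the $m$ consecutive integers from $m+3$ to $2m+2$. The sum over $k$ is empty (zero) if $[(m+1)/2]<2$. *)

(* Defs.v *)
From mathcomp Require Export all_boot all_order all_algebra.

Set Implicit Arguments.
Unset Strict Implicit.
Unset Printing Implicit Defensive.

(* Main.v *)
Require Import Defs.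
From mathcomp Require Import all_boot all_order all_algebra.
From mathcomp Require Import zify ring.

Import GRing.Theory.
Local Open Scope ring_scope.

(** Put [n = m + 1].  The [k]-th summand is the square of the ballot number
    ['C(n, k) - 'C(n, k - 1)] ([ballot_closed]; the terms [1] and
    [m ^ 2] are those for [k = 0] and [k = 1]), so the claim is that the squares
    of the ballot numbers with [k <= n / 2] add up to the Catalan number
    [(2n)! / (n! (n + 1)!)].

    Writing the ballot number as ['C(n, k) - 'C(n, n + 1 - k)] shows that it
    changes sign under [k |-> n + 1 - k].  Its square is therefore symmetric,
    and vanishes at the middle index when there is one, so the sum over
    [k <= n / 2] is half of the sum over [0 <= k <= n + 1] ([sum_sym_half]).
    Expanding the squares in the full sum, each of the three resulting sums is
    a Vandermonde convolution, and together they give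
    [2 ('C(2n, n) - 'C(2n, n + 1))] ([sum_ballot_sqr]).  That difference is
    again a ballot number, for [2n] and [n], and its closed form is the Catalan
    number. *)

(** The ballot number ['C(n, k) - 'C(n, k - 1)]; the reflected lower index makes
    the antisymmetry under [k |-> n + 1 - k] evident and gives the right value
    at [k = 0]. *)
Definition ballot (n k : nat) : rat := 'C(n, k)%:R - 'C(n, n.+1 - k)%:R.

Lemma natr_fact_neq0 n : n`!%:R != 0 :> rat.
Proof. by rewrite Num.Theory.pnatr_eq0 -lt0n fact_gt0. Qed.

Lemma natr_bin (n k : nat) : (k <= n)%N ->
  'C(n, k)%:R = n`!%:R / (k`!%:R * (n - k)`!%:R) :> rat.
Proof.
move=> le_kn; rewrite -(bin_fact le_kn) 2!natrM mulfK //.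
by rewrite mulf_neq0 ?natr_fact_neq0.
Qed.

(** Used twice: for the summands of the theorem, and, at [2n] and [n], for the
    Catalan number on the other side. *)
Lemma ballot_closed (n k : nat) : (0 < k <= n)%N ->
  ballot n k = n`!%:R / (n.+1 - k)`!%:R * (n.+1%:R - 2 * k%:R) / k`!%:R.
Proof.
case: k => [|i] //= lt_in; rewrite /ballot subSS.
rewrite !natr_bin ?leq_subr // subKn; last exact: ltnW.
(* With [i = k - 1] and [j = n - k], all the factorials in the denominators are
   small multiples of [i!] and [j!], and both sides become
   [n! (j - i) / ((i + 1)! (j + 1)!)]. *)
have [j ->] : exists j, n = (i + j.+1)%N by exists (n - i.+1)%N; lia.
have -> : (i + j.+1 - i.+1 = j)%N by lia.
have -> : (i + j.+1 - i = j.+1)%N by lia.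
move: (natr_fact_neq0 i) (natr_fact_neq0 j) => nzi nzj.
rewrite (factS i) (factS j) !natrM.
have nzSi : 1 + i%:R != 0 :> rat by rewrite nat1r Num.Theory.pnatr_eq0.
have nzSj : 1 + j%:R != 0 :> rat by rewrite nat1r Num.Theory.pnatr_eq0.
move: (i + j.+1)`! => N; field.
by rewrite nzSi nzSj nzi nzj.
Qed.

Lemma sum_bin_sqr n :
  \sum_(0 <= k < n.+2) 'C(n, k)%:R ^+ 2 = 'C(n + n, n)%:R :> rat.
Proof.
rewrite big_nat_recr //= bin_small // expr0n addr0.
rewrite -binomial.Vandermonde natr_sum big_mkord.
by apply: eq_bigr => k _; rewrite natrM bin_sub // -ltnS.
Qed.

(** Expanding the square gives Vandermonde convolutions: the lower indices of the
    cross term add up to [n + 1], and those of the square terms add up to [n]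
    once one of the two factors is rewritten by ['C(n, k) = 'C(n, n - k)]. *)
Lemma sum_ballot_sqr n :
  \sum_(0 <= k < n.+2) ballot n k ^+ 2 = 2 * ballot (n + n) n.
Proof.
have rev_sqr : \sum_(0 <= k < n.+2) 'C(n, n.+1 - k)%:R ^+ 2 = 'C(n + n, n)%:R :> rat.
  by rewrite big_nat_rev -sum_bin_sqr; apply: eq_big_nat => k ?; do 3!f_equal; lia.
have cross : \sum_(0 <= k < n.+2) 'C(n, k)%:R * 'C(n, n.+1 - k)%:R
           = 'C(n + n, n.+1)%:R :> rat.
  rewrite -binomial.Vandermonde natr_sum big_mkord.
  by apply: eq_bigr => k _; rewrite natrM.
under eq_bigr do rewrite /ballot sqrrB.
rewrite big_split sumrB /= sum_bin_sqr rev_sqr sumrMnl cross /ballot.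
have -> : ((n + n).+1 - n = n.+1)%N by lia.
ring.
Qed.

(** The reflection [k |-> n + 1 - k] of [{0, ..., n + 1}] exchanges the indices
    below and above [(n + 1) / 2]; for odd [n] it fixes the midpoint, whose term
    is counted once only and so has to vanish. *)
Lemma sum_sym_half (V : nmodType) (n : nat) (f : nat -> V) :
    (forall k, (k <= n.+1)%N -> f (n.+1 - k)%N = f k) ->
    (forall k, k.*2 = n.+1 -> f k = 0) ->
  \sum_(0 <= k < n.+2) f k = (\sum_(0 <= k < (n %/ 2).+1) f k) *+ 2.
Proof.
move=> f_sym f_mid; rewrite (big_cat_nat (n := (n %/ 2).+1)) //=; last by lia.
rewrite mulr2n; congr (_ + _).
(* The upper part, reflected, is the sum over [0 <= k <= uphalf n]. *)
rewrite -{1}[(n %/ 2).+1]add0n big_addn.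
have -> : (n.+2 - (n %/ 2).+1 = (uphalf n).+1)%N by rewrite uphalf_half; lia.
rewrite big_nat_rev.
transitivity (\sum_(0 <= k < (uphalf n).+1) f k).
  apply: eq_big_nat => k k_le; rewrite -f_sym.
    by congr f; move: k_le; rewrite uphalf_half; lia.
  by move: k_le; rewrite uphalf_half; lia.
(* For odd [n] this has one more index, the midpoint [(n + 1) / 2]. *)
have [odd_n|even_n] := boolP (odd n).
  have -> : uphalf n = (n %/ 2).+1 by rewrite uphalf_half; lia.
  rewrite big_nat_recr //= f_mid ?addr0 //; lia.
by have -> : uphalf n = (n %/ 2)%N by rewrite uphalf_half; lia.
Qed.

Lemma sum_half_ballot_sqr n :
  \sum_(0 <= k < (n %/ 2).+1) ballot n k ^+ 2 = ballot (n + n) n.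
Proof.
have two_neq0 : 2 != 0 :> rat by [].
apply: (mulfI two_neq0).
rewrite -sum_ballot_sqr [RHS]sum_sym_half ?mulr_natl //.
  by move=> k le_k; rewrite /ballot subKn // -sqrrN opprB.
move=> k k_mid; rewrite /ballot.
have -> : (n.+1 - k = k)%N by lia.
by rewrite subrr expr0n.
Qed.

Lemma prod_nat_fact (a b : nat) : (a <= b)%N ->
  \prod_(a.+1 <= j < b.+1) j%:R = b`!%:R / a`!%:R :> rat.
Proof.
move=> le_ab; apply: (mulIf (natr_fact_neq0 a)).
rewrite divfK ?natr_fact_neq0 // !fact_prod.
rewrite [in RHS](big_cat_nat (n := a.+1)) //=.
by rewrite natrM !natr_prod mulrC.
Qed.

Theorem corollary4p17 (m : nat) (m_gt0 : (0 < m)%N) :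
  1 + m%:R ^+ 2
    + \sum_(2 <= k < ((m + 1) %/ 2).+1)
        ((\prod_(m - k + 3 <= j < (m + 1).+1) j%:R) * (m%:R + 2 - 2 * k%:R)
           / (k`!)%:R) ^+ 2
  = (\prod_(m + 3 <= j < (2 * m + 2).+1) j%:R) / ((m + 1)`!)%:R :> rat.
Proof.
have -> : (m + 3 = (m + 2).+1)%N by lia.
rewrite prod_nat_fact; last by lia.
have catalan : (2 * m + 2)`!%:R / (m + 2)`!%:R / (m + 1)`!%:R
             = ballot (m + 1 + (m + 1)) (m + 1) :> rat.
  rewrite ballot_closed; last by lia.
  have -> : ((m + 1 + (m + 1)).+1 - (m + 1) = m + 2)%N by lia.
  have -> : (m + 1 + (m + 1) = 2 * m + 2)%N by lia.
  have -> : (2 * m + 2).+1%:R - 2 * (m + 1)%:R = 1 :> rat by ring.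
  by rewrite mulr1.
(* The terms [k = 0] and [k = 1] are the summands [1] and [m ^ 2]. *)
rewrite catalan -sum_half_ballot_sqr.
rewrite [RHS]big_ltn // [in RHS]big_ltn; last by lia.
rewrite [RHS]addrA; congr (_ + _ + _).
- by rewrite /ballot bin0 subn0 bin_small // subr0 expr1n.
- congr (_ ^+ 2); rewrite /ballot bin1 subSS subn0 binn; ring.
apply: eq_big_nat => k k_le; rewrite ballot_closed; last by lia.
have -> : (m - k + 3 = ((m + 1).+1 - k).+1)%N by lia.
rewrite prod_nat_fact; last by lia.
by congr ((_ * _ / _) ^+ 2); ring.
Qed.
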